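(* For every real $\delta>0$ there exists an integer $K(\delta)\geq 1$ such that, for every $E\subseteq\mathbb{Z}^2$ satisfying $d^\star(E)\geq\delta$, $$K(\delta)\mathbb{Z}\subseteq P(E)=\{xy:(x,y)\in E-E\}.$$
   Context: For $E\subseteq\mathbb{Z}^2$, $E-E=\{u-v:u,v\in E\}$ and $P(E):=\{xy:(x,y)\in E-E\}\subseteq\mathbb{Z}$. The upper Banach density of $A\subseteq\mathbb{Z}^2$ is $$d^\star(A):=\lim_{N\to\infty}\sup_{z\in\mathbb{Z}^2}\frac{|A\cap(z+[-N,N]^2)|}{(2N+1)^2},$$ where $[-N,N]^2$ denotes the set of integer points in that square. $K\mathbb{Z}$ denotes the set of integer multiples of $K$. *)

(* Defs.v *)
From mathcomp Require Import all_boot all_order all_algebra finmap.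
From mathcomp Require Import all_classical all_reals all_analysis.

Set Implicit Arguments.
Unset Strict Implicit.
Unset Printing Implicit Defensive.

Import Order.TTheory GRing.Theory Num.Theory.
Import numFieldNormedType.Exports.

Local Open Scope classical_set_scope.
Local Open Scope ring_scope.

Definition square (z : int * int) (N : nat) : set (int * int) :=
  [set u | `|u.1 - z.1| <= N%:Z /\ `|u.2 - z.2| <= N%:Z].

(* [fset_set] is the empty set on infinite sets, but squares are finite. *)
Definition square_ratio (R : realType) (A : set (int * int))
    (N : nat) (z : int * int) : R :=
  #|` fset_set (A `&` square z N)|%:R / ((2 * N + 1) ^ 2)%N%:R.

(* The ratios lie in [0, 1], so [sup] is a genuine supremum. The sequence of
   suprema converges for every [A], so [lim] never takes its default value. *)
Definition upper_banach_density (R : realType) (A : set (int * int)) : R :=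
  limn (fun N : nat => sup (range (square_ratio R A N))).

Definition difference_set (E : set (int * int)) : set (int * int) :=
  [set u - v | u in E & v in E].

Definition product_set (E : set (int * int)) : set int :=
  [set p.1 * p.2 | p in difference_set E].

Definition multiples (K : int) : set int := range (fun n : int => K * n).

(* Main.v *)
From HB Require Import structures.
Require Import Defs.
From mathcomp Require Import all_boot all_order all_algebra finmap.
From mathcomp Require Import all_classical all_reals all_analysis.
From mathcomp Require Import ring lra zify.

Set Implicit Arguments.
Unset Strict Implicit.
Unset Printing Implicit Defensive.

Import Order.TTheory GRing.Theory Num.Theory.
Import numFieldNormedType.Exports.

Local Open Scope classical_set_scope.
Local Open Scope ring_scope.

(** The theorem follows from a statement about finite abelian groups,
    [density_hyperbola_finite]: there is a K depending only on delta such that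
    whenever A has density at least delta in G, and alpha, beta lie in G, some
    positive integers x, y with x y = K satisfy
    x alpha + y beta \in A - A. Indeed a large square in which E is dense embeds
    in a torus (Z/M)^2 whose side exceeds that of the square by enough that the
    relevant differences do not wrap around. Taking alpha = (1, 0) and
    beta = (0, n) produces a difference (x, n y) of E, whose coordinates have
    product K n; since n is absorbed in beta, K does not depend on it.

    For the finite statement, let c(m, n) be the proportion of points of A that
    stay in A under translation by m alpha + n beta. The hyperbolas x y = const
    are permuted by the maps (x, y) |-> (t x, y) and (x, y) |-> (x, t y), which
    have the same effect on the product x y. Averaging c over the dilations
    (m, n) |-> (d m, D n) for a suitable family of pairs with d D constant
    yields a function P, still positive definite, with P(t m, n) close to
    P(m, t n) for all small t ([averaged_overlap]). Hence P(m, n) is close to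
    P(1, m n) when m <> 0: away from the vertical axis, P depends only on the
    area m n. If the conclusion fails for a suitable K, then P vanishes on all
    positive points of the hyperbola m n = N!.

    By positive definiteness, P(z - w) is the inner product of unit vectors f_z
    and f_w. All the P(0, r) with r <> 0 small are nearly equal, so the vectors
    f_(0, r) are equicorrelated, and the means of two families of N of them
    are at distance O(N^(-1/2)). Taking the inner product with f_(1, 0) shows
    that two families of N points have nearly the same mean of P, provided that
    no area occurs more than twice in either family ([spread_average]).

    Now let v be the mean of f_p over the N points p = (k, N!/k) of the
    hyperbola, and w the mean of f_q over the points q = (-k, -k). For each
    point p or q, its differences with the points of either family have areas of
    multiplicity at most two, so |v|^2, <v, w> and |w|^2 all nearly agree, and
    they nearly equal <f_0, w>. Hence |v - w| is small. But |w|^2 >= delta,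
    so <f_0, v> >= delta - o(1), while <f_0, v> = 0 because P vanishes on the
    hyperbola: a contradiction for large N ([correlation_meets_hyperbola]). *)

(** * Averaging over dilations *)

(** A finite form of the amenability of the multiplicative group of positive
    rationals. The pairs are (\prod_t t ^ e_t, \prod_t t ^ (L - e_t)) for
    1 <= t <= B and exponents 0 <= e_t < L: multiplying the first component by t
    instead of the second amounts to incrementing e_t, so that the sum over e_t
    telescopes and only a fraction 1/L survives. *)
Lemma dilation_averaging_family (R : realFieldType) (B L : nat) :
    (0 < L)%N ->
  exists (s : seq (nat * nat)) (K : nat),
    [/\ (0 < size s)%N, (0 < K)%N, {in s, forall p, (p.1 * p.2)%N = K} &
      forall (t : nat) (phi : nat -> nat -> R), (0 < t <= B)%N ->
        (forall x y, 0 <= phi x y <= 1) ->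
        `|\sum_(p <- s) (phi (t * p.1)%N p.2 - phi p.1 (t * p.2)%N)|
          <= (size s)%:R / L%:R].
Proof.
move=> L_gt0; have LR_gt0 : 0 < L%:R :> R by rewrite ltr0n.
elim: B => [|B [s [K [s_gt0 K_gt0 sK avg]]]].
  exists [:: (1, 1)%N], 1%N; split=> //; last by move=> [|t].
  by move=> p; rewrite inE => /eqP ->.
exists [seq ((p.1 * B.+1 ^ i)%N, (p.2 * B.+1 ^ (L - i))%N) | p <- s, i <- iota 0 L].
exists (K * B.+1 ^ L)%N; split.
- by rewrite size_allpairs size_iota muln_gt0 s_gt0.
- by rewrite muln_gt0 K_gt0 expn_gt0.
- move=> q /allpairsP[[p i] /= [ps]]; rewrite mem_iota add0n /= => iL ->.
  by rewrite /= mulnACA -expnD subnKC 1?ltnW // sK.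
move=> t phi /andP[t_gt0]; rewrite leq_eqVlt => /orP[/eqP ->|t_le] phi01.
- rewrite big_allpairs_dep /= size_allpairs size_iota natrM mulfK ?gt_eqF //.
  apply: (le_trans (ler_norm_sum _ _ _)).
  rewrite -[X in _ <= X]mulr1 mulr_natl -[size s]card_ord -sumr_const.
  rewrite (big_nth (0, 0)%N) big_mkord; apply: ler_sum => j _.
  set p := nth _ _ _.
  (* The exponent of B.+1 in the second factor runs from L.+1 down to 1, which
     accounts for the extra factor t carried by one of the two components. *)
  pose u i := phi (p.1 * B.+1 ^ i)%N (p.2 * B.+1 ^ (L.+1 - i))%N.
  rewrite -[L in iota 0 L]subn0 -/(index_iota 0 L).
  rewrite (eq_big_nat _ _ (F2 := fun i => u i.+1 - u i)); last first.
    move=> i /= iL; congr (_ - _); congr phi.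
    + by rewrite expnS mulnCA.
    + by rewrite subSn 1?ltnW // expnS mulnCA.
  rewrite telescope_sumr //.
  have /andP[? ?] := phi01 (p.1 * B.+1 ^ L)%N (p.2 * B.+1 ^ (L.+1 - L))%N.
  have /andP[? ?] := phi01 (p.1 * B.+1 ^ 0)%N (p.2 * B.+1 ^ (L.+1 - 0))%N.
  by rewrite /u ler_norml; apply/andP; split; lra.
- rewrite big_allpairs_dep /= exchange_big /= size_allpairs size_iota.
  apply: (le_trans (ler_norm_sum _ _ _)).
  have -> : (size s * L)%:R / L%:R = \sum_(i <- iota 0 L) (size s)%:R / L%:R :> R.
    by rewrite big_const_seq count_predT size_iota iter_addr_0 -[RHS]mulr_natr natrM mulrAC.
  apply: ler_sum => i _.
  pose psi x y := phi (x * B.+1 ^ i)%N (y * B.+1 ^ (L - i))%N.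
  have := avg t psi; rewrite t_gt0 -ltnS t_le => /(_ isT (fun x y => phi01 _ _)).
  congr (`| _ | <= _); apply: eq_bigr => p _.
  by rewrite /psi !mulnA.
Qed.

(** * Positive definite correlations *)

(** The inner product of \sum_(x <- s) x.1 f_(x.2) and \sum_(y <- t) y.1 f_(y.2)
    when P (z - w) is read as the inner product of f_z and f_w. *)
Definition gram (R : realFieldType) (V : zmodType) (P : V -> R)
    (s t : seq (R * V)) : R :=
  \sum_(x <- s) \sum_(y <- t) x.1 * y.1 * P (x.2 - y.2).

Definition overlap (R : realFieldType) (G : finZmodType) (A : {set G}) (g : G) : R :=
  (\sum_(a in A) (a + g \in A)%:R) / #|A|%:R.

Lemma overlap_ge0_le1 (R : realFieldType) (G : finZmodType) (A : {set G}) (g : G) :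
  0 <= overlap R A g <= 1.
Proof.
apply/andP; split; first by rewrite divr_ge0 ?ler0n // sumr_ge0 // => a _; rewrite ler0n.
have [A0|A_gt0] := posnP #|A|.
  by rewrite /overlap A0 invr0 mulr0 ler01.
rewrite ler_pdivrMr ?ltr0n // mul1r -[#|A|]sum1_card natr_sum.
by apply: ler_sum => a _; case: (_ \in _); rewrite ?ler01.
Qed.

Lemma overlap0 (R : realFieldType) (G : finZmodType) (A : {set G}) :
  (0 < #|A|)%N -> overlap R A 0 = 1.
Proof.
move=> A_gt0; rewrite /overlap.
under eq_bigr => a aA do rewrite addr0 aA.
by rewrite sumr_const divff // pnatr_eq0 -lt0n.
Qed.

(** Overlaps are inner products of translates of the indicator function of A,
    scaled to have norm one. *)
Lemma overlapB (R : realFieldType) (G : finZmodType) (A : {set G}) (u v : G) :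
  overlap R A (u - v) =
  (\sum_g (g + u \in A)%:R * (g + v \in A)%:R) / #|A|%:R.
Proof.
congr (_ / _); rewrite big_mkcond [RHS](reindex_inj (addIr (- v))) /=.
apply: eq_bigr => g _; rewrite subrK addrAC addrA.
by case: (g \in A); rewrite ?mulr1 ?mulr0.
Qed.

Lemma overlapN (R : realFieldType) (G : finZmodType) (A : {set G}) (g : G) :
  overlap R A (- g) = overlap R A g.
Proof.
rewrite -[- g]add0r -[in RHS](subr0 g) !overlapB.
by congr (_ / _); apply: eq_bigr => a _; rewrite mulrC.
Qed.

Lemma sqr_sum_le_card (R : realFieldType) (G : finType) (h : G -> R) :
  (\sum_g h g) ^+ 2 <= #|G|%:R * \sum_g h g ^+ 2.
Proof.
set S := \sum_g h g; set Q := \sum_g _; set n := #|G|%:R.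
have [G0|G_gt0] := posnP #|G|.
  by rewrite /n /S G0 mul0r big1 ?expr0n // => g; have := max_card (pred1 g); rewrite card1 G0.
have n_gt0 : 0 < n by rewrite ltr0n.
have : 0 <= \sum_g (h g - S / n) ^+ 2 by apply: sumr_ge0 => g _; exact: sqr_ge0.
have -> : \sum_g (h g - S / n) ^+ 2 = Q - S ^+ 2 / n.
  under eq_bigr => g _ do rewrite sqrrB.
  rewrite big_split /= sumrB sumrMnl -mulr_suml -/S -/Q sumr_const.
  rewrite -[X in _ + X]mulr_natr -/n; field.
  by rewrite gt_eqF.
by rewrite subr_ge0 ler_pdivrMr // mulrC.
Qed.

(** The Gram form of the overlaps is the squared norm of a function on G whose
    sum over G is known; Cauchy-Schwarz against the constant function gives not
    just positivity but a lower bound by the density of A. *)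
Lemma gram_overlap_ge (R : realFieldType) (G : finZmodType) (A : {set G})
    (delta : R) (s : seq (R * G)) :
    (0 < #|A|)%N -> delta * #|G|%:R <= #|A|%:R ->
  delta * (\sum_(x <- s) x.1) ^+ 2 <= gram (overlap R A) s s.
Proof.
move=> A_gt0 densA; have AR_gt0 : 0 < #|A|%:R :> R by rewrite ltr0n.
have GR_gt0 : 0 < #|G|%:R :> R by rewrite ltr0n (leq_trans A_gt0) ?max_card.
pose h g := \sum_(x <- s) x.1 * (g + x.2 \in A)%:R : R.
have -> : gram (overlap R A) s s = (\sum_g h g ^+ 2) / #|A|%:R.
  rewrite /gram; under eq_bigr => x _ do under eq_bigr => y _ do rewrite overlapB mulrA.
  under eq_bigr => x _ do rewrite -mulr_suml.
  rewrite -mulr_suml; congr (_ / _).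
  under eq_bigr => x _ do under eq_bigr => y _ do rewrite mulr_sumr.
  under eq_bigr => x _ do rewrite exchange_big /=.
  rewrite exchange_big /=; apply: eq_bigr => g _.
  rewrite expr2 /h mulr_suml; apply: eq_bigr => x _.
  by rewrite mulr_sumr; apply: eq_bigr => y _; ring.
have sumh : \sum_g h g = (\sum_(x <- s) x.1) * #|A|%:R.
  rewrite /h exchange_big mulr_suml /=; apply: eq_bigr => x _.
  rewrite -mulr_sumr; congr (_ * _).
  rewrite (reindex_inj (addIr (- x.2))) /=.
  under eq_bigr => g _ do rewrite subrK.
  by rewrite -sum1_card natr_sum [RHS]big_mkcond; apply: eq_bigr => g _; case: ifP.
have := sqr_sum_le_card h; rewrite sumh => CS.
rewrite ler_pdivlMr //; set S := \sum_(x <- s) _ in CS *.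
have S2 := sqr_ge0 S.
rewrite -(ler_pM2l GR_gt0); apply: le_trans CS.
rewrite exprMn [leRHS]mulrA; nra.
Qed.

(** What survives of the set A in the rest of the argument.
    [correlation_dilate] is the approximate symmetry under which only the area
    m n matters, and [correlation_gram] combines positive definiteness with the
    density delta. *)
Record hyperbolic_correlation (R : realFieldType) (B L : nat) (delta : R)
    (P : int * int -> R) : Prop := HyperbolicCorrelation {
  correlation0 : P 0 = 1;
  correlation_ge0_le1 : forall z, 0 <= P z <= 1;
  correlationN : forall z, P (- z) = P z;
  correlation_dilate : forall (t : nat) (m n : int), (0 < t <= B)%N ->
    `|P (t%:Z * m, n) - P (m, t%:Z * n)| <= L%:R^-1;
  correlation_gram : forall s : seq (R * (int * int)),
    delta * (\sum_(x <- s) x.1) ^+ 2 <= gram P s s }.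

(** Every dilated point (d m, D n) has product K m n with the same K, which is
    how one integer K can serve all the dilations at once: if the averaged
    overlap is nonzero at (m, n), then one of the dilated points, each of
    product K m n, is a difference of elements of A. *)
Lemma averaged_overlap (R : realFieldType) (B L : nat) : (0 < L)%N ->
  exists K : nat, (0 < K)%N /\
    forall (delta : R) (G : finZmodType) (A : {set G}) (alpha beta : G),
      (0 < #|A|)%N -> delta * #|G|%:R <= #|A|%:R ->
    exists P : int * int -> R, hyperbolic_correlation B L delta P /\
      forall m n : nat, P (m%:Z, n%:Z) != 0 ->
        exists x y : nat, (x * y)%N = (K * (m * n))%N /\
          exists a b : G, [/\ a \in A, b \in A & a - b = alpha *+ x + beta *+ y].
Proof.
move=> L_gt0; have [s [K [s_gt0 K_gt0 sK avg]]] := dilation_averaging_family R B L_gt0.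
exists K; split=> // delta G A alpha beta A_gt0 densA.
have sR_gt0 : 0 < (size s)%:R :> R by rewrite ltr0n.
pose pt (p : nat * nat) (z : int * int) : G :=
  alpha *~ (p.1%:Z * z.1) + beta *~ (p.2%:Z * z.2).
have ptB p z w : pt p (z - w) = pt p z - pt p w.
  by rewrite /pt /= !mulrBr !mulrzBr opprD addrACA.
pose P z := (\sum_(p <- s) overlap R A (pt p z)) / (size s)%:R.
have P01 z : 0 <= P z <= 1.
  apply/andP; split.
    by rewrite divr_ge0 ?ler0n // sumr_ge0 // => p _; case/andP: (overlap_ge0_le1 R A (pt p z)).
  rewrite ler_pdivrMr // mul1r -sum1_size natr_sum.
  by apply: ler_sum => p _; case/andP: (overlap_ge0_le1 R A (pt p z)).
exists P; split; first split=> //.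
- rewrite /P; under eq_bigr => p _ do
    rewrite /pt !mulr0 !mulr0z addr0 overlap0 //.
  rewrite (_ : \sum_(p <- s) 1 = (size s)%:R) ?divff ?gt_eqF //.
  by rewrite -sum1_size natr_sum.
- move=> z; congr (_ / _); apply: eq_bigr => p _.
  by rewrite -overlapN; congr overlap; rewrite /pt /= !mulrN !mulrNz opprD !opprK.
- move=> t m n t_le.
  pose phi x y := overlap R A (alpha *~ (x%:Z * m) + beta *~ (y%:Z * n)).
  have := avg t phi t_le (fun _ _ => overlap_ge0_le1 _ _ _).
  rewrite mulrC -ler_pdivrMr //; apply: le_trans.
  rewrite le_eqVlt; apply/orP; left; apply/eqP.
  rewrite /P -mulrBl normrM -sumrB [ `|_^-1| ]ger0_norm ?invr_ge0 ?ler0n //.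
  congr (`|_| / _); apply: eq_bigr => p _; rewrite /phi /pt /=.
  by congr (overlap R A (_ *~ _ + _ *~ _) - overlap R A (_ *~ _ + _ *~ _)); lia.
- move=> u.
  have -> : gram P u u =
      (\sum_(p <- s) gram (overlap R A) [seq (x.1, pt p x.2) | x <- u]
         [seq (x.1, pt p x.2) | x <- u]) / (size s)%:R.
    rewrite /gram; under [in RHS]eq_bigr => p _ do rewrite big_map.
    rewrite [in RHS]exchange_big mulr_suml /=; apply: eq_bigr => x _.
    under [in RHS]eq_bigr => p _ do rewrite big_map.
    rewrite [in RHS]exchange_big mulr_suml /=; apply: eq_bigr => y _.
    rewrite /P mulrA mulr_sumr; congr (_ / _); apply: eq_bigr => p _.
    by rewrite ptB.
  rewrite ler_pdivlMr // mulr_natr -sum1_size -sumrMnr.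
  apply: ler_sum => p _; rewrite mulr1n.
  by have := gram_overlap_ge [seq (x.1, pt p x.2) | x <- u] A_gt0 densA; rewrite big_map.
move=> m n Pmn.
have /hasP[p ps] : has (fun p => overlap R A (pt p (m%:Z, n%:Z)) != 0) s.
  apply: contraNT Pmn => /hasPn all0; rewrite /P big_seq big1 ?mul0r // => p /all0.
  by rewrite negbK => /eqP.
move=> ov; have [a aA baA] : exists2 a, a \in A & a + pt p (m%:Z, n%:Z) \in A.
  apply/exists_inP; apply: contraNT ov => /exists_inPn none.
  by rewrite /overlap big1 ?mul0r // => a /none /negPf ->.
exists (p.1 * m)%N, (p.2 * n)%N; split; first by rewrite mulnACA sK.
exists (a + pt p (m%:Z, n%:Z)), a; split=> //.
by rewrite addrC addKr /pt /= -!PoszM !pmulrn.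
Qed.

(** Cauchy-Schwarz for f_w against \sum_(x <- s) x.1 f_(x.2): the quadratic form
    is nonnegative on s extended by f_w with the optimal coefficient. *)
Lemma gram_Cauchy_Schwarz (R : realFieldType) (B L : nat) (delta : R)
    (P : int * int -> R) (w : int * int) (s : seq (R * (int * int))) :
    0 <= delta -> hyperbolic_correlation B L delta P ->
  (\sum_(x <- s) x.1 * P (w - x.2)) ^+ 2 <= gram P s s.
Proof.
move=> delta_ge0 PH; set S := \sum_(x <- s) _.
have := correlation_gram PH ((- S, w) :: s).
move=> /(le_trans (mulr_ge0 delta_ge0 (sqr_ge0 _))).
rewrite /gram big_cons big_cons /= subrr (correlation0 PH) mulr1.
have -> : \sum_(x <- s) - S * x.1 * P (w - x.2) = - S * S.
  by rewrite /S mulr_sumr; apply: eq_bigr => x _; rewrite mulrA.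
under [X in _ + X]eq_bigr => x _ do rewrite big_cons /= -opprB (correlationN PH).
rewrite big_split /=.
have -> : \sum_(x <- s) x.1 * - S * P (w - x.2) = - S * S.
  by rewrite {3}/S mulr_sumr; apply: eq_bigr => x _; ring.
set Q := \sum_(x <- s) _; lra.
Qed.

(** Cauchy-Schwarz for f_w against \sum_k f_(y k) - \sum_k f_(z k). *)
Lemma family_Cauchy_Schwarz (R : realFieldType) (B L N : nat) (delta : R)
    (P : int * int -> R) (w : int * int) (y z : 'I_N -> int * int) :
    0 <= delta -> hyperbolic_correlation B L delta P ->
  (\sum_k P (w - y k) - \sum_k P (w - z k)) ^+ 2 <=
  \sum_i (\sum_k P (y i - y k) - \sum_k P (y i - z k)) -
  \sum_i (\sum_k P (y k - z i) - \sum_k P (z i - z k)).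
Proof.
move=> delta_ge0 PH.
pose s := [seq (1 : R, y k) | k <- index_enum 'I_N] ++ [seq (- 1 : R, z k) | k <- index_enum 'I_N].
have sumE (F : R * (int * int) -> R) :
    \sum_(x <- s) F x = \sum_k F (1, y k) + \sum_k F (- 1, z k).
  by rewrite /s big_cat !big_map.
have := gram_Cauchy_Schwarz w s delta_ge0 PH.
rewrite /gram !sumE /=.
under eq_bigr do rewrite mul1r; under [\sum_k -1 * _]eq_bigr do rewrite mulN1r.
rewrite sumrN; congr (_ <= _).
under eq_bigr => i _ do rewrite sumE /=.
under [X in _ + X]eq_bigr => i _ do rewrite sumE /=.
rewrite -[X in _ = _ + X]sumrN; congr (_ + _); apply: eq_bigr => i _.
  under eq_bigr do rewrite !mul1r; under [\sum_k 1 * -1 * _]eq_bigr do rewrite mul1r mulN1r.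
  by rewrite sumrN.
under eq_bigr do rewrite mulN1r mulN1r -opprB (correlationN PH).
under [\sum_k -1 * -1 * _]eq_bigr do rewrite mulrNN !mul1r.
by rewrite sumrN opprB addrC.
Qed.

Lemma family_gram_ge (R : realFieldType) (B L N : nat) (delta : R)
    (P : int * int -> R) (y : 'I_N -> int * int) :
    hyperbolic_correlation B L delta P ->
  delta * N%:R ^+ 2 <= \sum_i \sum_k P (y i - y k).
Proof.
move=> PH; have := correlation_gram PH [seq (1, y k) | k <- index_enum 'I_N].
rewrite /gram !big_map /= sumr_const card_ord.
under eq_bigr => i _ do rewrite big_map /=.
by under eq_bigr do under eq_bigr do rewrite !mul1r.
Qed.

(** * Averages along families of nearly distinct areas *)

Lemma mulrn_inv_le1 (R : realFieldType) (N : nat) : N%:R^-1 *+ N <= 1 :> R.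
Proof.
have [->|N_gt0] := posnP N; first by rewrite mulr0n ler01.
by rewrite -(mulr_natr N%:R^-1) mulVf // pnatr_eq0 -lt0n.
Qed.

Definition area (z : int * int) : int := z.1 * z.2.

(** The admissible families. A vanishing difference is allowed because the
    families of differences contain the zero difference of a point with itself.
    Areas may occur twice, as they do for differences along a hyperbola or a
    diagonal; what matters is a bound on multiplicities that is independent of
    N. The factor 2 keeps differences of two areas below B. *)
Definition spread (B N : nat) (y : 'I_N -> int * int) : Prop :=
  [/\ forall k, y k = 0 \/ (0 < `|(y k).1| <= B)%N,
      forall k, (2 * `|area (y k)| <= B)%N &
      forall i j k, uniq [:: i; j; k] -> area (y i) = area (y j) ->
        area (y i) = area (y k) -> False].

Lemma spread_fiber (R : realFieldType) (B N : nat) (y : 'I_N -> int * int) (r : int) :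
  spread B y -> \sum_k (area (y k) == r)%:R <= 2%:R :> R.
Proof.
case=> _ _ yU; rewrite -natr_sum ler_nat.
have -> : (\sum_k (area (y k) == r) = #|[pred k | area (y k) == r]|)%N.
  by rewrite -sum1_card [RHS]big_mkcond; apply: eq_bigr => k _; rewrite inE; case: eqP.
rewrite leqNgt; apply/negP => /card_gt2P[i [j [k [[/eqP ir /eqP jr /eqP kr] [ij jk ki]]]]].
apply: (yU i j k); rewrite ?ir ?jr ?kr //=.
by rewrite !inE negb_or ij jk eq_sym ki.
Qed.

(** Move the factor z.1 from the first coordinate to the second. *)
Lemma correlation_area (R : realFieldType) (B L : nat) (delta : R)
    (P : int * int -> R) (z : int * int) :
    hyperbolic_correlation B L delta P -> (0 < `|z.1| <= B)%N ->
  `|P z - P (1, area z)| <= L%:R^-1.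
Proof.
move=> PH zB; have [z1_ge0|z1_lt0] := leP 0 z.1.
  have := correlation_dilate PH 1 z.2 zB.
  by rewrite mulr1 gez0_abs // -surjective_pairing.
have := correlation_dilate PH 1 (- z.2) zB.
rewrite mulr1 ltz0_abs // mulrNN -(correlationN PH z).
by case: z {zB z1_lt0}.
Qed.

(** The point (0, n) arises from (0, 1) by dilating the second coordinate by n;
    the same dilation of the first coordinate fixes (0, 1). *)
Lemma correlation_vertical (R : realFieldType) (B L : nat) (delta : R)
    (P : int * int -> R) (n : int) :
    hyperbolic_correlation B L delta P -> (0 < `|n| <= B)%N ->
  `|P (0, n) - P (0, 1)| <= L%:R^-1.
Proof.
move=> PH nB; have [n_ge0|n_lt0] := leP 0 n.
  have := correlation_dilate PH 0 1 nB.
  by rewrite mulr0 mulr1 gez0_abs // distrC.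
have := correlation_dilate PH 0 1 nB.
rewrite mulr0 mulr1 ltz0_abs // distrC -(correlationN PH (0, n)).
by rewrite (_ : - (0, n) = (0, - n)) //; congr pair; rewrite oppr0.
Qed.

(** Each of the N terms changes by at most 1/N, except for the at most two terms
    with y k = 0, which may change by 1. *)
Lemma spread_sum_area (R : realFieldType) (B N : nat) (delta : R)
    (P : int * int -> R) (y : 'I_N -> int * int) :
    hyperbolic_correlation B N delta P -> spread B y ->
  `|\sum_k P (y k) - \sum_k P (1, area (y k))| <= 3%:R.
Proof.
move=> PH yS; rewrite -sumrB; apply: (le_trans (ler_norm_sum _ _ _)).
apply: (@le_trans _ _ (\sum_(k < N) (N%:R^-1 + (area (y k) == 0)%:R))).
  apply: ler_sum => k _; have [y1 _ _] := yS; case: (y1 k) => [->|kB].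
    rewrite (_ : area 0 = 0) // eqxx ler_wpDl ?invr_ge0 ?ler0n //.
    have /andP[? ?] := correlation_ge0_le1 PH 0.
    have /andP[? ?] := correlation_ge0_le1 PH (1, 0).
    by rewrite /= mulr1n ler_norml; apply/andP; split; lra.
  by rewrite ler_wpDr ?ler0n // (correlation_area PH).
rewrite big_split /= sumr_const card_ord (_ : 3%:R = 1 + 2%:R) -?natrD // lerD //.
  exact: mulrn_inv_le1.
exact: spread_fiber yS.
Qed.

(** The vectors f_(0, r) have a common inner product P (0, 1) for distinct r, up
    to 1/N; at most 2 N of the N ^ 2 pairs have equal areas. *)
Lemma spread_vertical_gram_le (R : realFieldType) (B N : nat) (delta : R)
    (P : int * int -> R) (y : 'I_N -> int * int) :
    hyperbolic_correlation B N delta P -> spread B y ->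
  \sum_i \sum_k P (0, area (y k) - area (y i)) <= N%:R ^+ 2 * P (0, 1) + 3%:R * N%:R.
Proof.
move=> PH yS.
have P1 := correlation_ge0_le1 PH; have [P1a P1b] := andP (P1 (0, 1)).
apply: (@le_trans _ _ (\sum_(i < N) \sum_(k < N)
    (P (0, 1) + N%:R^-1 + (area (y k) == area (y i))%:R))).
  apply: ler_sum => i _; apply: ler_sum => k _.
  have [->|/eqP ki] := eqVneq (area (y k)) (area (y i)).
    have /andP[_ ?] := P1 (0, area (y i) - area (y i)).
    by rewrite (le_trans (y := 1)) // ler_wpDl // addr_ge0 // invr_ge0 ler0n.
  have [_ yB _] := yS; have := correlation_vertical (n := area (y k) - area (y i)) PH.
  have := yB i; have := yB k => ? ? /(_ ltac:(lia)).
  by rewrite ler_norml addr0 => /andP[_]; rewrite lerBlDl.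
apply: (@le_trans _ _ (\sum_(i < N) (N%:R * P (0, 1) + 3%:R))).
  apply: ler_sum => i _; rewrite big_split /= sumr_const card_ord mulrnDl -mulr_natl.
  have := spread_fiber R (area (y i)) yS.
  have := mulrn_inv_le1 R N.
  lra.
by rewrite sumr_const card_ord -mulr_natl; lra.
Qed.

(** Coinciding areas only help here, since they contribute 1 >= P (0, 1). *)
Lemma spread_vertical_gram_ge (R : realFieldType) (B N : nat) (delta : R)
    (P : int * int -> R) (y z : 'I_N -> int * int) :
    hyperbolic_correlation B N delta P -> spread B y -> spread B z ->
  N%:R ^+ 2 * P (0, 1) - N%:R <= \sum_i \sum_k P (0, area (y k) - area (z i)).
Proof.
move=> PH [_ yB _] [_ zB _].
have P1 := correlation_ge0_le1 PH; have [P1a P1b] := andP (P1 (0, 1)).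
apply: (@le_trans _ _ (\sum_(i < N) \sum_(k < N) (P (0, 1) - N%:R^-1))).
  rewrite !sumr_const !card_ord -mulrnA -(mulr_natr (P (0, 1) - N%:R^-1)) natrM.
  have [->|N_gt0] := posnP N; first by rewrite expr0n !mul0r mulr0 subrr.
  have N0 : N%:R != 0 :> R by rewrite pnatr_eq0 -lt0n.
  by rewrite le_eqVlt; apply/orP; left; apply/eqP; field.
apply: ler_sum => i _; apply: ler_sum => k _.
have [->|/eqP ki] := eqVneq (area (y k)) (area (z i)).
  by rewrite subrr (correlation0 PH) (le_trans (y := P (0, 1))) // gerBl invr_ge0 ler0n.
have := correlation_vertical (n := area (y k) - area (z i)) PH.
have := yB k; have := zB i => ? ? /(_ ltac:(lia)).
by rewrite ler_norml => /andP[+ _]; rewrite lerBrDl.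
Qed.

(** With r running over the two families of areas, the sums of the vectors
    f_(0, - r) are at squared distance at most 8 N, because the common
    inner product P (0, 1) cancels. Pairing with f_(1, 0) turns this into a
    comparison of the values P (1, r), that is, of P along the two families. *)
Lemma spread_average (R : realFieldType) (B N : nat) (delta tau : R)
    (P : int * int -> R) (y z : 'I_N -> int * int) :
    0 <= delta -> hyperbolic_correlation B N delta P ->
    0 < tau <= 1 -> 8%:R <= tau ^+ 2 * N%:R ->
    spread B y -> spread B z ->
  `|\sum_k P (y k) - \sum_k P (z k)| <= 2%:R * tau * N%:R.
Proof.
move=> delta_ge0 PH /andP[tau_gt0 tau_le1] N_ge yS zS.
set Y := \sum_k P (y k); set Z := \sum_k P (z k).
have Yar := spread_sum_area PH yS; have Zar := spread_sum_area PH zS.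
pose S := \sum_k P (1, area (y k)) - \sum_k P (1, area (z k)).
have tN : 8%:R <= tau * N%:R.
  by apply: (le_trans N_ge); rewrite ler_wpM2r ?ler0n // expr2 ler_piMl // ltW.
suff S_le : `|S| <= tau * N%:R.
  move: Yar Zar S_le; rewrite -/Y -/Z /S !ler_norml => /andP[? ?] /andP[? ?] /andP[? ?].
  by apply/andP; split; lra.
have S2 : S ^+ 2 <= 8%:R * N%:R.
  have := family_Cauchy_Schwarz (1, 0) (fun k => (0, - area (y k)))
    (fun k => (0, - area (z k))) delta_ge0 PH.
  have subE (a b c d : int) : (a, b) - (c, d) = (a - c, b - d) by [].
  under eq_bigr do rewrite subE subr0 sub0r opprK.
  under [X in (_ - X) ^+ 2]eq_bigr do rewrite subE subr0 sub0r opprK.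
  rewrite -/S => /le_trans; apply.
  under eq_bigr => i _.
    under eq_bigr do rewrite subE subr0 opprK addrC.
    under [X in _ - X]eq_bigr do rewrite subE subr0 opprK addrC.
    over.
  under [X in _ - X]eq_bigr => i _.
    under eq_bigr do rewrite subE subr0 opprK addrC.
    under [X in _ - X]eq_bigr do rewrite subE subr0 opprK addrC.
    over.
  rewrite !sumrB [X in _ - (X - _)]exchange_big /=.
  have := spread_vertical_gram_le PH yS; have := spread_vertical_gram_le PH zS.
  have := spread_vertical_gram_ge PH yS zS; have := spread_vertical_gram_ge PH zS yS.
  lra.
have tN_ge0 : 0 <= tau * N%:R by rewrite mulr_ge0 ?ler0n ?ltW.
rewrite -(@ler_pXn2r _ 2%N) ?nnegrE // real_normK ?num_real //.
apply: (le_trans S2); rewrite exprMn [_ ^+ 2 * _]mulrA.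
by rewrite ler_wpM2r ?ler0n.
Qed.

(** * The configuration of points *)

Definition hyperbola_point (N : nat) (k : 'I_N) : int * int :=
  (k.+1%:Z, (N`! %/ k.+1)%N%:Z).

(** The signs keep the first coordinates away from those of the hyperbola
    points, so that differences between the two families avoid the vertical
    axis, where the area carries no information. *)
Definition diagonal_point (N : nat) (k : 'I_N) : int * int :=
  (- k.+1%:Z, - k.+1%:Z).

Lemma hyperbola_point_mul (N : nat) (k : 'I_N) : (k.+1 * (N`! %/ k.+1) = N`!)%N.
Proof. by rewrite mulnC divnK // dvdn_fact //= ltn_ord. Qed.

Definition configuration_bound (N : nat) : nat := (4 * N * (N`! + N))%N.

(** Differences within the configuration have first coordinate at most 2 N and
    second coordinate at most N! + N in absolute value. *)
Lemma configuration_boundP (N : nat) (y : 'I_N -> int * int) :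
    (forall k, y k = 0 \/ (y k).1 <> 0) ->
    (forall k, `|(y k).1| <= 2 * N)%N -> (forall k, `|(y k).2| <= N`! + N)%N ->
    (forall i j k, uniq [:: i; j; k] -> area (y i) = area (y j) ->
      area (y i) = area (y k) -> False) ->
  spread (configuration_bound N) y.
Proof.
move=> y0 y1 y2 yU; have N_fact := fact_gt0 N; split=> // k.
- case: (y0 k) => [->|yk]; [by left | right].
  have := y1 k; rewrite /configuration_bound; nia.
- rewrite /area abszM; have := leq_mul (y1 k) (y2 k); rewrite /configuration_bound; nia.
Qed.

Lemma ord_succ_inj (N : nat) (i j : 'I_N) : i.+1%:Z = j.+1%:Z -> i = j.
Proof. by move=> ij; apply: val_inj => /=; lia. Qed.

(** The chord between the points with abscissas x and y of the hyperbola of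
    product M has area - M (x - y) ^ 2 / (x y), a function of y / x + x / y.
    Hence the area determines y up to the symmetry y |-> x ^ 2 / y. *)
Lemma hyperbola_chord_area (M x y z a b c : int) :
    M != 0 -> x * a = M -> y * b = M -> z * c = M ->
    (x - y) * (a - b) = (x - z) * (a - c) ->
  y = z \/ x * x = y * z.
Proof.
move=> M0 xa yb zc areas.
have area1 : x * y * z * ((x - y) * (a - b)) = - (M * (z * (x - y) ^+ 2)).
  transitivity (z * (x - y) * (y * (x * a) - x * (y * b))); first ring.
  by rewrite xa yb; ring.
have area2 : x * y * z * ((x - z) * (a - c)) = - (M * (y * (x - z) ^+ 2)).
  transitivity (y * (x - z) * (z * (x * a) - x * (z * c))); first ring.
  by rewrite xa zc; ring.
have : M * ((y - z) * (x * x - y * z)) = 0.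
  transitivity (M * (y * (x - z) ^+ 2) - M * (z * (x - y) ^+ 2)); first ring.
  by move: area1; rewrite areas area2 => /oppr_inj ->; rewrite subrr.
move=> /eqP; rewrite !mulf_eq0 (negPf M0) !subr_eq0 /= => /orP[]/eqP; [by left | by right].
Qed.

Lemma spread_hyperbola_hyperbola (N : nat) (i : 'I_N) :
  spread (configuration_bound N) (fun k : 'I_N => hyperbola_point i - hyperbola_point k).
Proof.
have quo_le k : (N`! %/ k <= N`!)%N by exact: leq_div.
apply: configuration_boundP => [k|k|k|j k l] /=.
- have [->|ik] := eqVneq i k; first by left; rewrite subrr.
  by right => ik0; case/eqP: ik; apply: ord_succ_inj; lia.
- by have := ltn_ord i; have := ltn_ord k; lia.
- have := quo_le i.+1; have := quo_le k.+1.
  by move: (_ %/ i.+1)%N (_ %/ k.+1)%N => a b; lia.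
have M0 : N`!%:Z != 0 by rewrite eqz_nat -lt0n fact_gt0.
have pointM (m : 'I_N) : m.+1%:Z * (N`! %/ m.+1)%N%:Z = N`!%:Z.
  by rewrite -PoszM hyperbola_point_mul.
rewrite !inE negb_or /= => /and3P[/andP[jk jl] kl _] ajk ajl.
have := hyperbola_chord_area M0 (pointM i) (pointM j) (pointM k) ajk.
have := hyperbola_chord_area M0 (pointM i) (pointM j) (pointM l) ajl.
move=> [/ord_succ_inj jl'|ijl]; first by rewrite jl' eqxx in jl.
move=> [/ord_succ_inj jk'|ijk]; first by rewrite jk' eqxx in jk.
case/eqP: kl; apply: ord_succ_inj; move: ijk; rewrite ijl => /mulfI.
by move=> /(_ isT) ->.
Qed.

Lemma spread_hyperbola_diagonal (N : nat) (i : 'I_N) :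
  spread (configuration_bound N) (fun k : 'I_N => hyperbola_point i - diagonal_point k).
Proof.
apply: configuration_boundP => [k|k|k|j k l] /=.
- by right; lia.
- by have := ltn_ord i; have := ltn_ord k; lia.
- by have := leq_div N`! i.+1; have := ltn_ord k; lia.
rewrite !inE negb_or /= => /and3P[/andP[/eqP jk _] _ _] ajk _.
apply: jk; apply: val_inj; move: ajk; rewrite /area /= !opprK -!PoszD -!PoszM.
by set c := (N`! %/ _)%N; move=> [] /=; nia.
Qed.

Lemma spread_diagonal_hyperbola (N : nat) (i : 'I_N) :
  spread (configuration_bound N) (fun k : 'I_N => hyperbola_point k - diagonal_point i).
Proof.
apply: configuration_boundP => [k|k|k|j k l] /=.
- by right; lia.
- by have := ltn_ord i; have := ltn_ord k; lia.
- by have := leq_div N`! k.+1; have := ltn_ord i; lia.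
rewrite !inE negb_or /= => /and3P[/andP[jk jl] kl _] ajk ajl.
(* With t = i.+1, the area is (k + t) (N! / k + t) = N! + t (k + N! / k) + t ^ 2,
   which determines k up to the symmetry k |-> N! / k. *)
have key (m n : 'I_N) : m != n ->
    area (hyperbola_point m - diagonal_point i) =
    area (hyperbola_point n - diagonal_point i) -> (m.+1 * n.+1 = N`!)%N.
  move=> mn; rewrite /area /= !opprK -!PoszD -!PoszM => -[].
  have := hyperbola_point_mul m; have := hyperbola_point_mul n.
  set a := (_ %/ m.+1)%N; set b := (_ %/ n.+1)%N => nb ma.
  have {}mn : m.+1 <> n.+1 by move=> [] /val_inj /eqP; rewrite (negPf mn).
  move: nb ma mn; move: N`! m.+1 n.+1 i.+1 (ltn0Sn i) => M x y t t_gt0 yb xa xy areas.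
  have sums : (x + a = y + b)%N.
    apply/eqP; rewrite -(eqn_pmul2l t_gt0); apply/eqP.
    by move: areas; rewrite !mulnDl !mulnDr; lia.
  have /eqP : (x%:Z - y%:Z) * (a%:Z - y%:Z) = 0.
    transitivity (x%:Z * a%:Z - y%:Z * (x%:Z + a%:Z - y%:Z)); first ring.
    have -> : x%:Z + a%:Z - y%:Z = b%:Z by lia.
    by rewrite -!PoszM xa yb subrr.
  by rewrite mulf_eq0 => /orP[]/eqP ?; [lia | have -> : y = a by lia].
have := key _ _ jk ajk; have := key _ _ jl ajl => <- /eqP.
by rewrite eqn_pmul2l // eqSS => /eqP/val_inj kl'; rewrite kl' eqxx in kl.
Qed.

Lemma spread_diagonal_diagonal (N : nat) (i : 'I_N) :
  spread (configuration_bound N) (fun k : 'I_N => diagonal_point i - diagonal_point k).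
Proof.
apply: configuration_boundP => [k|k|k|j k l] /=.
- have [->|ik] := eqVneq i k; first by left; rewrite subrr.
  by right => ik0; case/eqP: ik; apply: ord_succ_inj; lia.
- by have := ltn_ord i; have := ltn_ord k; lia.
- by have := ltn_ord i; have := ltn_ord k; lia.
rewrite !inE negb_or /= => /and3P[/andP[/eqP jk /eqP jl] /eqP kl _].
rewrite /area /= => ajk ajl; apply: kl; apply: ord_succ_inj.
have {}jk : j.+1%:Z <> k.+1%:Z by move/ord_succ_inj.
have {}jl : j.+1%:Z <> l.+1%:Z by move/ord_succ_inj.
move: jk jl ajk ajl; move: i.+1%:Z j.+1%:Z k.+1%:Z l.+1%:Z => x a b c ab ac ajk ajl.
(* The area is a square, which determines the point up to reflection in i. *)
have reflect u : a <> u ->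
    (- x - - a) * (- x - - a) = (- x - - u) * (- x - - u) -> a + u = 2 * x.
  move=> au squares; have /eqP : (a - u) * (a + u - 2 * x) = 0 by lia.
  by rewrite mulf_eq0 => /orP[]/eqP ?; lia.
by have := reflect b ab ajk; have := reflect c ac ajl; lia.
Qed.

Lemma spread_origin_diagonal (N : nat) :
  spread (configuration_bound N) (fun k : 'I_N => 0 - diagonal_point k).
Proof.
apply: configuration_boundP => [k|k|k|j k l] /=.
- by right; lia.
- by have := ltn_ord k; lia.
- by have := ltn_ord k; lia.
rewrite !inE negb_or /= => /and3P[/andP[/eqP jk _] _ _] ajk _.
by apply: jk; apply: val_inj; move: ajk; rewrite /area /=; nia.
Qed.

(** * Correlations meet the hyperbola *)

(** If P vanished on the hyperbola, the sum T of the inner products of f_0 with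
    the diagonal points would satisfy T ^ 2 <= 4 tau N ^ 2, because
    \sum_k f_(p k) is orthogonal to f_0 and close to \sum_k f_(q k). But T nearly
    equals 1/N times the squared norm of \sum_k f_(q k), which is at least
    delta N ^ 2, so that T >= (delta - 2 tau) N. For tau = delta ^ 2 / 16 the
    two bounds are incompatible. *)
Lemma correlation_meets_hyperbola (R : realFieldType) (N : nat) (delta : R)
    (P : int * int -> R) :
    0 < delta <= 1 -> 8%:R <= (delta ^+ 2 / 16%:R) ^+ 2 * N%:R ->
    hyperbolic_correlation (configuration_bound N) N delta P ->
  exists k : 'I_N, P (hyperbola_point k) != 0.
Proof.
move=> /andP[delta_gt0 delta_le1] N_ge PH; have delta_ge0 := ltW delta_gt0.
set tau := delta ^+ 2 / 16%:R in N_ge.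
have tau01 : 0 < tau <= 1 by rewrite /tau; apply/andP; split; nra.
have [N_eq0|N_gt0] := posnP N; first by move: N_ge; rewrite N_eq0 mulr0; lra.
have NR_gt0 : 0 < N%:R :> R by rewrite ltr0n.
apply/existsP; apply: contraT => /existsPn P0.
pose p := @hyperbola_point N; pose q := @diagonal_point N.
pose T := \sum_k P (0 - q k).
have close y z := spread_average delta_ge0 PH tau01 N_ge (y := y) (z := z).
have gramq_le : \sum_i \sum_k P (q i - q k) <= N%:R * (T + 2%:R * tau * N%:R).
  rewrite mulr_natl -[X in _ <= _ *+ X]card_ord -sumr_const; apply: ler_sum => i _.
  have := close _ _ (spread_diagonal_diagonal i) (spread_origin_diagonal N).
  by rewrite ler_norml -/T => /andP[_]; rewrite lerBlDl.
have gramq_ge := family_gram_ge q PH.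
have T_sqr_le : T ^+ 2 <= 4%:R * tau * N%:R ^+ 2.
  have := family_Cauchy_Schwarz 0 p q delta_ge0 PH.
  rewrite big1 => [|k _]; last first.
    by have := P0 k; rewrite negbK sub0r (correlationN PH) => /eqP.
  rewrite sub0r sqrrN -/T => /le_trans; apply.
  rewrite -sumrB.
  apply: (@le_trans _ _ (\sum_(i < N) 4%:R * tau * N%:R)); last first.
    by rewrite sumr_const card_ord -[_ *+ N]mulr_natl expr2; lra.
  apply: ler_sum => i _.
  have := close _ _ (spread_hyperbola_hyperbola i) (spread_hyperbola_diagonal i).
  have := close _ _ (spread_diagonal_hyperbola i) (spread_diagonal_diagonal i).
  by rewrite !ler_norml -/p -/q => /andP[? ?] /andP[? ?]; lra.
have T_ge : (delta - 2%:R * tau) * N%:R <= T.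
  by rewrite -(ler_pM2l NR_gt0); lra.
have tauE : tau * 16%:R = delta ^+ 2 by rewrite divfK // pnatr_eq0.
have T_ge' : 7%:R * delta * N%:R <= 8%:R * T.
  suff : 7%:R * delta * N%:R <= 8%:R * ((delta - 2%:R * tau) * N%:R) by lra.
  have : 16%:R * tau * N%:R <= delta * N%:R by rewrite ler_pM2r //; nra.
  lra.
have : (7%:R * delta * N%:R) ^+ 2 <= (8%:R * T) ^+ 2.
  by rewrite lerXn2r // nnegrE ?(le_trans _ T_ge') // !mulr_ge0 // ler0n.
rewrite !exprMn -tauE => contra.
have : 0 < tau * N%:R ^+ 2 by rewrite mulr_gt0 ?exprn_gt0 //; case/andP: tau01.
lra.
Qed.

Theorem density_hyperbola_finite (R : archiRealFieldType) (delta : R) :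
    0 < delta ->
  exists K : nat, (0 < K)%N /\
    forall (G : finZmodType) (A : {set G}) (alpha beta : G),
      delta * #|G|%:R <= #|A|%:R ->
    exists x y : nat, (x * y)%N = K /\
      exists a b : G, [/\ a \in A, b \in A & a - b = alpha *+ x + beta *+ y].
Proof.
move=> delta_gt0; pose delta' := Num.min delta 1.
have delta'01 : 0 < delta' <= 1 by rewrite /delta' lt_min delta_gt0 ltr01 ge_min lexx orbT.
set c := (delta' ^+ 2 / 16%:R) ^+ 2.
have c_gt0 : 0 < c.
  by rewrite exprn_gt0 // divr_gt0 ?ltr0n // exprn_gt0 //; case/andP: delta'01.
pose N := Num.bound (8%:R / c).
have N_ge : 8%:R <= c * N%:R.
  by rewrite mulrC -ler_pdivrMr // ltW // archi_boundP // divr_ge0 ?ler0n // ltW.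
have N_gt0 : (0 < N)%N.
  by rewrite lt0n; apply: contraTneq N_ge => ->; rewrite mulr0 -ltNge ltr0n.
have [K [K_gt0 realize]] := averaged_overlap R (configuration_bound N) N_gt0.
exists (K * N`!)%N; split; first by rewrite muln_gt0 K_gt0 fact_gt0.
move=> G A alpha beta densA.
have G_gt0 : (0 < #|G|)%N by apply/card_gt0P; exists 0.
have A_gt0 : (0 < #|A|)%N.
  by rewrite -(ltr0n R) (lt_le_trans _ densA) // mulr_gt0 // ltr0n.
have densA' : delta' * #|G|%:R <= #|A|%:R.
  by apply: le_trans densA; rewrite ler_pM2r ?ltr0n // ge_min lexx.
have [P [PH hit]] := realize delta' G A alpha beta A_gt0 densA'.
have [k /hit[x [y [xy ab]]]] := correlation_meets_hyperbola delta'01 N_ge PH.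
by exists x, y; rewrite xy hyperbola_point_mul.
Qed.

HB.instance Definition _ (G H : finZmodType) := GRing.Zmodule.on (G * H)%type.

(** * From dense planar sets to dense subsets of a torus *)

Lemma square_ratio_gt_half (R : realType) (delta : R) (E : set (int * int)) (W : nat) :
    0 < delta -> delta <= upper_banach_density R E ->
  exists (N : nat) (z : int * int), (W <= N)%N /\ delta / 2 < square_ratio R E N z.
Proof.
move=> delta_gt0 densE; apply: contrapT => none.
suff : upper_banach_density R E <= delta / 2 by lra.
rewrite /upper_banach_density.
have [cv|/dvgP ->] := pselect (cvgn (fun N => sup (range (square_ratio R E N)))); last first.
  (* A divergent sequence has limit 0 by convention, which is below delta. *)
  by rewrite (_ : point = 0 :> R) // divr_ge0 // ltW.
apply: limr_le => //; exists W => // N /= WN; rewrite leNgt; apply/negP => /sup_gt[].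
  by exists (square_ratio R E N 0); exists 0.
by move=> _ [z _ <-] ratio; apply: none; exists N, z.
Qed.

Lemma intr_Zp_eq0 (M : nat) (x : int) :
  (1 < M)%N -> (`|x| < M)%N -> x%:~R = 0 :> 'Z_M -> x = 0.
Proof.
move=> M_gt1; wlog x_ge0 : x / 0 <= x => [wl|].
  have [/wl//|x_lt0 xM x0] := leP 0 x; apply: oppr_inj; rewrite oppr0.
  by apply: wl; [lia | lia | rewrite mulrNz x0 oppr0].
case: x x_ge0 => // n _ /= nM /(congr1 val) /=.
by rewrite -pmulrn val_Zp_nat // modn_small // => ->.
Qed.

Lemma int_dist_le (a b c : int) (N : nat) :
  `|a - c| <= N%:Z -> `|b - c| <= N%:Z -> `|a - b| <= (2 * N)%N%:Z.
Proof. by lia. Qed.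

Lemma pair_mulrn (G H : zmodType) (g : G) (h : H) (k : nat) :
  (g, h) *+ k = (g *+ k, h *+ k).
Proof. by elim: k => [|k IH]; rewrite ?mulr0n // !mulrSr IH. Qed.

(** The side of the torus exceeds the diameter of the square, so reduction
    modulo M is injective on the square. *)
Lemma torus_model (E : set (int * int)) (N M : nat) (z : int * int) :
    (2 * N < M)%N -> (1 < M)%N ->
  exists A : {set 'Z_M * 'Z_M}, #|A| = #|` fset_set (E `&` square z N)| /\
    forall a, a \in A -> exists2 u, (E `&` square z N) u & a = (u.1%:~R, u.2%:~R).
Proof.
move=> NM M_gt1; set F := fset_set _.
have inF u : u \in F -> (E `&` square z N) u.
  rewrite /F; have [fin|inf] := pselect (finite_set (E `&` square z N)).
    by rewrite in_fset_set // inE.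
  by rewrite /fset_set; case: pselect.
pose f (u : int * int) : 'Z_M * 'Z_M := (u.1%:~R, u.2%:~R).
exists (finset (fun a => a \in [seq f u | u <- enum_fset F])); split.
  rewrite cardsE (card_uniqP _) ?size_map //.
  rewrite map_inj_in_uniq ?fset_uniq // => u v /inF[_ [u1 u2]] /inF[_ [v1 v2]] [] uv1 uv2.
  have eqM x y : `|x - y| <= (2 * N)%N%:Z -> x%:~R = y%:~R :> 'Z_M -> x = y.
    move=> xyN xy; apply/eqP; rewrite -subr_eq0; apply/eqP.
    by apply: (intr_Zp_eq0 M_gt1); [lia | rewrite mulrzBr xy subrr].
  apply: injective_projections.
    by apply: eqM uv1; exact: int_dist_le u1 v1.
  by apply: eqM uv2; exact: int_dist_le u2 v2.
by move=> a; rewrite inE => /mapP[u /inF uE ->]; exists u.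
Qed.

Theorem theorem1p5 (R : realType) (delta : R) (delta_gt0 : 0 < delta) :
  exists K : int, 1 <= K /\
    forall E : set (int * int),
      delta <= upper_banach_density R E -> multiples K `<=` product_set E.
Proof.
have [K [K_gt0 realize]] := density_hyperbola_finite (divr_gt0 delta_gt0 (ltr0n R 8)).
exists K%:Z; split=> // E densE _ [n _ <-].
have [N [z [WN ratio]]] := square_ratio_gt_half (K * `|n|.+1) delta_gt0 densE.
(* Differences in the square have coordinates at most 2 N, and x, |n y| <= K |n|.+1,
   so congruences modulo M between them are equalities; and M <= 2 (2 N + 1),
   which costs a factor 4 in density. *)
pose M := (2 * N + K * `|n|.+1).+1.
have M_gt1 : (1 < M)%N by rewrite /M; nia.
have NM : (2 * N < M)%N by rewrite /M; lia.
have [A [cardA liftA]] := torus_model E z NM M_gt1.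
have densA : delta / 8%:R * #|{: 'Z_M * 'Z_M}|%:R <= #|A|%:R.
  rewrite cardA card_prod !card_ord Zp_cast //.
  have N_gt0 : 0 < ((2 * N + 1) ^ 2)%N%:R :> R by rewrite ltr0n expn_gt0 addn1.
  move: ratio; rewrite /square_ratio ltr_pdivlMr // => /ltW; apply: le_trans.
  have : (M * M)%:R <= (4 * (2 * N + 1) ^ 2)%N%:R :> R by rewrite ler_nat /M; nia.
  rewrite !natrM; nra.
have [x [y [xyK [a [b [/liftA[u [uE [u1 u2]] ->] /liftA[v [vE [v1 v2]] ->] ab]]]]]] :=
  realize ('Z_M * 'Z_M)%type A (1, 0) (0, n%:~R) densA.
have [x_gt0 y_gt0] : (0 < x)%N /\ (0 < y)%N.
  by apply/andP; rewrite -muln_gt0 xyK.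
have x_le : (x <= K * `|n|.+1)%N by rewrite -xyK; nia.
have ny_le : (`|(n * y%:Z)%R| <= K * `|n|.+1)%N by rewrite abszM -xyK /=; nia.
have lift (c d w : int) : `|c - d| <= (2 * N)%N%:Z -> (`|w| <= K * `|n|.+1)%N ->
    c%:~R - d%:~R = w%:~R :> 'Z_M -> c - d = w.
  move=> cd w_le cdw; apply/eqP; rewrite -subr_eq0; apply/eqP.
  by apply: (intr_Zp_eq0 M_gt1); [rewrite /M; lia | rewrite !mulrzBr cdw subrr].
rewrite !pair_mulrn in ab.
have uv1 : u.1 - v.1 = x%:Z.
  apply: (lift _ _ x%:Z (int_dist_le u1 v1) x_le).
  by have /= -> := congr1 fst ab; rewrite mul0rn addr0.
have uv2 : u.2 - v.2 = n * y%:Z.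
  apply: (lift _ _ (n * y%:Z) (int_dist_le u2 v2) ny_le).
  by have /= -> := congr1 snd ab; rewrite mul0rn add0r intrM mulr_natr.
exists (u - v); first by exists u => //; exists v.
by rewrite /= uv1 uv2 -xyK PoszM; ring.
Qed.
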